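(* Let $P$ be a polyhedron. All circuit walks in $P$ are reversible if and only if all circuit walks in $P$ are vertex walks.
   Context: For a polyhedron $P=\{x\in\mathbb R^n: Ax=b,\ Bx\le d\}$ with rational matrices $A,B$, the set of circuits $\mathcal C(A,B)$ consists of all $g\in\ker(A)\setminus\{0\}$ with coprime integer components such that the support of $Bg$ is inclusion-minimal among the supports of the vectors $Bx$, $x\in\ker(A)\setminus\{0\}$ (note $\mathcal C(A,B)=-\mathcal C(A,B)$). For vertices $v^{(1)},v^{(2)}$ of $P$, a circuit walk of length $k$ is a sequence $v^{(1)}=y^{(0)},\dots,y^{(k)}=v^{(2)}$ such that for $i=0,\dots,k-1$: $y^{(i)}\in P$; $y^{(i+1)}=y^{(i)}+\alpha_i g^{(i)}$ for some $g^{(i)}\in\mathcal C(A,B)$ and $\alpha_i>0$; and $y^{(i)}+\alpha g^{(i)}\notin P$ for all $\alpha>\alpha_i$ (maximal steps). A circuit walk is a vertex walk if every $y^{(i)}$ is a vertex of $P$. A circuit walk $y^{(0)},\dots,y^{(k)}$ is reversible if the reversed sequence $y^{(k)},y^{(k-1)},\dots,y^{(0)}$ is also a circuit walk in $P$. *)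

(* Defs.v *)
From HB Require Import structures.
From mathcomp Require Import all_boot all_order all_algebra.
From mathcomp Require Import boolp classical_sets reals.

Set Implicit Arguments.
Unset Strict Implicit.
Unset Printing Implicit Defensive.

Import Order.TTheory GRing.Theory Num.Theory.

Local Open Scope classical_set_scope.
Local Open Scope ring_scope.

Section Faces.
Variables (R : realType) (n : nat).
Implicit Types (P F : set 'cV[R]_n) (v : 'cV[R]_n).

(* [c] may be 0, so [P] itself and the empty set count as faces. *)
Definition is_face P F : Prop :=
  exists (c : 'rV[R]_n) (delta : R),
    (forall x, P x -> (c *m x) 0 0 <= delta) /\
    F = [set x | P x /\ (c *m x) 0 0 = delta].

Definition is_vertex P v : Prop := is_face P [set v].

End Faces.

Section Circuits.
Variables (R : realType) (n p q : nat).
Variables (A : 'M[rat]_(p, n)) (B : 'M[rat]_(q, n)).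
Variables (b : 'cV[R]_p) (d : 'cV[R]_q).

Local Notation AR := (map_mx (@ratr R) A).
Local Notation BR := (map_mx (@ratr R) B).

Definition polyhedron : set 'cV[R]_n :=
  [set x | AR *m x = b /\ forall i, (BR *m x) i 0 <= d i 0].

Definition supp m (u : 'cV[R]_m) : {set 'I_m} := [set i | u i 0 != 0]%SET.

Definition coprime_integral (g : 'cV[R]_n) : Prop :=
  exists z : 'cV[int]_n,
    g = map_mx intr z /\ \big[gcdn/0%N]_(i < n) absz (z i 0) = 1%N.

Definition circuits : set 'cV[R]_n :=
  [set g | [/\ AR *m g = 0, g != 0, coprime_integral g &
    forall x : 'cV[R]_n, AR *m x = 0 -> x != 0 ->
      ~~ (supp (BR *m x) \proper supp (BR *m g))]].

Definition maximal_circuit_step (x x' : 'cV[R]_n) : Prop :=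
  exists (g : 'cV[R]_n) (alpha : R),
    [/\ circuits g, 0 < alpha, x' = x + alpha *: g &
      forall alpha' : R, alpha < alpha' -> ~ polyhedron (x + alpha' *: g)].

(* A sequence y^(0), ..., y^(k) is given by [k] and [y : nat -> 'cV[R]_n];
   the values of [y] beyond [k] are irrelevant. *)
Definition circuit_walk (k : nat) (y : nat -> 'cV[R]_n) : Prop :=
  [/\ is_vertex polyhedron (y 0%N), is_vertex polyhedron (y k) &
    forall i, (i < k)%N ->
      polyhedron (y i) /\ maximal_circuit_step (y i) (y i.+1)].

Definition vertex_walk (k : nat) (y : nat -> 'cV[R]_n) : Prop :=
  circuit_walk k y /\ forall i, (i <= k)%N -> is_vertex polyhedron (y i).

Definition reversible (k : nat) (y : nat -> 'cV[R]_n) : Prop :=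
  circuit_walk k y /\ circuit_walk k (fun i => y (k - i)%N).

End Circuits.

(* Main.v *)
(** At a non-vertex point [y] of a polyhedron with a vertex, some circuit [g]
    vanishes on all constraints active at [y], so [y] can be moved both ways along
    [g]; since the polyhedron contains no line, one of [g], [-g] gives a maximal
    step, which activates a further constraint. Iterating, [y] is joined to a vertex
    by maximal circuit steps, the first of which is not reversible because
    the reversed step can be prolonged beyond [y]. Hence a circuit walk through a
    non-vertex can be rerouted into an irreversible one. Conversely, a step
    between vertices is reversible because vertices are extreme points. *)
Require Import Defs.
From mathcomp Require Import all_boot all_order all_algebra.
From mathcomp Require Import boolp classical_sets reals.
From mathcomp Require Import lra.

Set Implicit Arguments.
Unset Strict Implicit.
Unset Printing Implicit Defensive.

Import Order.TTheory GRing.Theory Num.Theory.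

Local Open Scope ring_scope.

(** * Scaling rational vectors to primitive integral ones *)

Lemma primitive_multiple n (g : 'cV[rat]_n) : g != 0 ->
  exists (z : 'cV[int]_n) (c : rat),
    map_mx intr z = c *: g /\ \big[gcdn/0%N]_(i < n) absz (z i 0) = 1%N.
Proof.
move=> g0.
pose N : int := \prod_(j < n) denq (g j 0).
(* Omitting the factor [denq (g i 0)] from [N] expresses [N * g i 0] as an integer. Dividing these
   integers by their gcd [G] then makes them coprime. *)
pose u i : int := numq (g i 0) * \prod_(j < n | j != i) denq (g j 0).
have uE i : (u i)%:~R = N%:~R * g i 0 :> rat.
  rewrite /u [N](bigD1 i) //= !intrM [RHS]mulrC mulrA.
  by rewrite -[X in _ = X * _ * _]divq_num_den divfK // intr_eq0 denq_eq0.
pose G := \big[gcdn/0%N]_(i < n) absz (u i).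
have Gdvd i : (G %| absz (u i))%N by rewrite /G (bigD1 i) //= dvdn_gcdl.
have N0 : N != 0 by apply/prodf_neq0 => i _; rewrite denq_eq0.
have G0 : (0 < G)%N.
  case/matrix0Pn: g0 => i [j]; rewrite ord1 => gi0.
  have := Gdvd i; case: (G) => [|//]; rewrite dvd0n absz_eq0 => /eqP ui0.
  have := uE i; rewrite ui0 => /esym/eqP.
  by rewrite mulf_eq0 intr_eq0 (negbTE N0) (negbTE gi0).
exists (\col_i (u i %/ G%:Z)%Z), (N%:~R / G%:~R).
have wE i : u i = (u i %/ G%:Z)%Z * G%:Z by rewrite divzK ?dvdzE ?Gdvd.
split.
  apply/matrixP => i j; rewrite !ord1 !mxE mulrAC -uE {2}wE rmorphM /= mulfK //.
  by rewrite pnatr_eq0 -lt0n.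
apply/eqP; rewrite -(eqn_pmul2l G0) muln1; apply/eqP.
rewrite (big_morph (muln G) (fun a b => muln_gcdr G a b) (muln0 G)).
by apply: eq_bigr => i _; rewrite mxE mulnC -[X in (_ * X)%N]/(absz G%:Z) -abszM -wE.
Qed.

Lemma mulmx_addZE (R : comNzRingType) m n (M : 'M[R]_(m, n)) (x u : 'cV[R]_n) r i :
  (M *m (x + r *: u)) i 0 = (M *m x) i 0 + r * (M *m u) i 0.
Proof. by rewrite mulmxDr -scalemxAr mxE [X in _ + X]mxE. Qed.

(** * Circuits with prescribed support *)

Section Circuits.
Variables (R : realType) (n p q : nat).
Variables (A : 'M[rat]_(p, n)) (B : 'M[rat]_(q, n)).
Variables (b : 'cV[R]_p) (d : 'cV[R]_q).

Local Notation AR := (map_mx (@ratr R) A).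
Local Notation BR := (map_mx (@ratr R) B).
Local Notation P := (polyhedron A B b d).
Local Notation slack y i := (d i 0 - (BR *m y) i 0).

(** The vector [x] is real, but the conditions on it cut out the kernel of a rational matrix. Rank
    does not change under field extension, so a nonzero rational solution exists, and it can be
    scaled to a primitive integral one. *)
Lemma primitive_kernel_vector (S : {set 'I_q}) (x : 'cV[R]_n) :
  AR *m x = 0 -> x != 0 -> supp (BR *m x) \subset S ->
  exists g : 'cV[R]_n,
    [/\ AR *m g = 0, g != 0, coprime_integral g & supp (BR *m g) \subset S].
Proof.
move=> Ax0 x0 /fintype.subsetP xS.
(* Zeroing the rows of [B] indexed by [S] leaves exactly the equations that force the support into
   [S]. *)
pose C := col_mx A (\matrix_(i, j) if i \in S then 0 else B i j).
have CE (y : 'cV[R]_n) : map_mx ratr C *m y = 0 <->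
    AR *m y = 0 /\ supp (BR *m y) \subset S.
  have EB i : (map_mx (@ratr R) (\matrix_(i, j) if i \in S then 0 else B i j)
      *m y) i 0 = if i \in S then 0 else (BR *m y) i 0.
    rewrite mxE; case: ifP => iS; last first.
      by rewrite mxE; apply: eq_bigr => j _; rewrite !mxE iS.
    by rewrite big1 // => j _; rewrite !mxE iS rmorph0 mul0r.
  rewrite map_col_mx mul_col_mx -col_mx0; split.
    case/eq_col_mx => -> /matrixP By; split=> //; apply/fintype.subsetP => i.
    rewrite inE; apply: contraNT => /negbTE iS.
    by have := By i 0; rewrite EB iS [RHS]mxE => ->.
  case=> -> /fintype.subsetP yS; congr col_mx; apply/matrixP => i j; rewrite ord1 EB [RHS]mxE.
  case: ifP => // iS; apply/eqP; apply: contraFT iS => Byi.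
  by apply: yS; rewrite inE.
have /negP : ~ row_free (map_mx (@ratr R) C^T).
  move=> Cfree; case/negP: x0; rewrite -trmx_eq0.
  rewrite -(mulmx_free_eq0 _ Cfree) -map_trmx -trmx_mul trmx_eq0; apply/eqP.
  by apply/CE; split=> //; apply/fintype.subsetP.
rewrite row_free_map -kermx_eq0 => /rowV0Pn [v /sub_kermxP vC v0].
have [|z [c [zE zgcd]]] := @primitive_multiple n v^T; first by rewrite trmx_eq0.
have zRE : map_mx intr z = ratr c *: map_mx ratr v^T :> 'cV[R]_n.
  rewrite -map_mxZ -zE -map_mx_comp; apply/matrixP => i j.
  by rewrite !mxE /= ratr_int.
exists (map_mx intr z).
have /CE [Az zS] : map_mx ratr C *m map_mx intr z = 0 :> 'cV[R]_(p + q).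
  rewrite zRE -scalemxAr -map_mxM /=.
  by rewrite -[C]trmxK -trmx_mul vC trmx0 map_mx0 scaler0.
split=> //; last by exists z.
apply/eqP => /matrixP z0; suff : \big[gcdn/0%N]_(i < n) absz (z i 0) = 0%N.
  by rewrite zgcd.
apply: (big_ind (fun k => k = 0%N)) => [//|? ? -> -> //|i _].
by have := z0 i 0; rewrite !mxE => /eqP; rewrite intr_eq0 => /eqP ->.
Qed.

(** Descent on the size of [S]: a primitive kernel vector is either support-minimal, hence a
    circuit, or some kernel vector has strictly smaller support, which replaces [S]. *)
Lemma circuit_of_support (S : {set 'I_q}) (x : 'cV[R]_n) :
  AR *m x = 0 -> x != 0 -> supp (BR *m x) \subset S ->
  exists2 g : 'cV[R]_n, circuits A B g & supp (BR *m g) \subset S.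
Proof.
move=> Ax0 x0 xS.
have [m] := ubnP #|S|; elim: m => // m IH in S x Ax0 x0 xS * => Sm.
have [g [Ag g0 gZ gS]] := primitive_kernel_vector Ax0 x0 xS.
have [[x' [Ax' x'0 x'g]]|gmin] := pselect (exists x' : 'cV[R]_n,
    [/\ AR *m x' = 0, x' != 0 & supp (BR *m x') \proper supp (BR *m g)]).
  have [|g' g'c g'S] := IH _ _ Ax' x'0 (subxx _).
    apply: leq_trans (proper_card x'g) _.
    by rewrite -ltnS (leq_trans _ Sm) // ltnS subset_leq_card.
  by exists g' => //; apply: fintype.subset_trans g'S (fintype.subset_trans (proper_sub x'g) gS).
exists g => //; split=> // x' Ax' x'0; apply/negP => x'g.
by apply: gmin; exists x'.
Qed.

Lemma circuitN (g : 'cV[R]_n) : circuits A B g -> circuits A B (- g).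
Proof.
have suppN m (u : 'cV[R]_m) : supp (- u) = supp u.
  by apply/setP => i; rewrite !inE mxE oppr_eq0.
case=> Ag g0 [z [gz zgcd]] gmin; split.
- by rewrite mulmxN Ag oppr0.
- by rewrite oppr_eq0.
- exists (- z); split; first by rewrite gz map_mxN.
  by rewrite -[RHS]zgcd; apply: eq_bigr => i _; rewrite mxE abszN.
- by rewrite mulmxN suppN.
Qed.

(** * Vertices, and directions available at other points *)

Lemma vertex_mem (Q : set 'cV[R]_n) v : is_vertex Q v -> Q v.
Proof.
by case=> c [delta [_ /seteqP [vQ _]]]; have [] := vQ v erefl.
Qed.

(** The functional exposing [v] cannot increase along [x] or along [-x], so it is constant there and
    [v + s *: x] lies in the face [[set v]]. *)
Lemma vertex_extreme (Q : set 'cV[R]_n) v (x : 'cV[R]_n) (s t : R) :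
  is_vertex Q v -> 0 < s -> 0 < t -> Q (v + s *: x) -> Q (v - t *: x) -> x = 0.
Proof.
case=> c [delta [cle /seteqP [vQ Qv]]] s0 t0 Qs Qt.
have [_ /= cv] := vQ v erefl.
have cE r : (c *m (v + r *: x)) 0 0 = delta + r * (c *m x) 0 0.
  by rewrite mulmx_addZE cv.
have cx0 : (c *m x) 0 0 = 0.
  apply/eqP; rewrite eq_le; apply/andP; split.
    by rewrite -(pmulr_rle0 _ s0); have := cle _ Qs; rewrite cE; lra.
  by rewrite -(pmulr_rge0 _ t0); have := cle _ Qt; rewrite -scaleNr cE; lra.
have /eqP : v + s *: x = v by apply: Qv; split=> //; rewrite cE cx0 mulr0 addr0.
by rewrite -subr_eq0 addrAC subrr add0r scaler_eq0 gt_eqF //= => /eqP.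
Qed.

Lemma polyhedron_addE y g (t : R) : P y -> AR *m g = 0 ->
  P (y + t *: g) <-> forall i, t * (BR *m g) i 0 <= slack y i.
Proof.
case=> Ay _ Ag.
split=> [[_ Py] i|Py]; first by have := Py i; rewrite mulmx_addZE; lra.
split=> [|i]; first by rewrite mulmxDr -scalemxAr Ag scaler0 addr0.
by have := Py i; rewrite mulmx_addZE; lra.
Qed.

Lemma slack_ge0 y i : P y -> 0 <= slack y i.
Proof. by case=> _ /(_ i); rewrite subr_ge0. Qed.

(** Otherwise [P] would contain a line in direction [x] through the vertex [v]. *)
Lemma pointed v (x : 'cV[R]_n) :
  is_vertex P v -> AR *m x = 0 -> BR *m x = 0 -> x = 0.
Proof.
move=> vP Ax Bx; have Pv := vertex_mem vP.
apply: (vertex_extreme (s := 1) (t := 1) vP) => //.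
  by apply/polyhedron_addE => // i; rewrite Bx mxE mulr0 slack_ge0.
by rewrite -scaleNr; apply/polyhedron_addE => // i; rewrite Bx mxE mulr0 slack_ge0.
Qed.

Lemma nonvertex_direction y : P y -> ~ is_vertex P y ->
  exists x : 'cV[R]_n, [/\ AR *m x = 0, x != 0 &
    supp (BR *m x) \subset supp (d - BR *m y)].
Proof.
move=> Py nvert; apply: contrapT => nodir; apply: nvert.
pose act i := slack y i == 0.
have cE x : ((\sum_(i | act i) row i BR) *m x) 0 0 =
    \sum_(i | act i) (BR *m x) i 0.
  rewrite mulmx_suml summxE; apply: eq_bigr => i _.
  by rewrite -row_mul mxE.
(* The sum of the active rows exposes the points of [P] at which all constraints active at [y] are
   tight. A second such point [x] would yield the direction [x - y]. *)
exists (\sum_(i | act i) row i BR), (\sum_(i | act i) d i 0); split.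
  by move=> x [_ Bx]; rewrite cE; apply: ler_sum.
apply/seteqP; split=> [_ ->|x [Px]] /=.
  split=> //; rewrite cE; apply: eq_bigr => i /eqP; lra.
rewrite cE => /esym/eqP; rewrite -subr_eq0 -sumrB => /eqP sum0.
have xact i : act i -> slack x i = 0.
  by apply: psumr_eq0P sum0 i => i _; rewrite slack_ge0.
apply: contrapT => xy; apply: nodir; exists (x - y); split.
- by rewrite mulmxBr Px.1 Py.1 subrr.
- by rewrite subr_eq0; apply/eqP.
apply/fintype.subsetP => i; rewrite !inE; apply: contraNN => yi.
have ai : act i by move: yi; rewrite /act 2!mxE.
apply/eqP; rewrite -scaleN1r mulmx_addZE; move: (xact i ai) (eqP ai); lra.
Qed.

Lemma bidirectional_step v y : is_vertex P v -> P y -> ~ is_vertex P y ->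
  exists (g : 'cV[R]_n) (alpha eps : R),
    [/\ 0 < alpha /\ 0 < eps, P (y - eps *: g), P (y + alpha *: g),
        maximal_circuit_step A B b d y (y + alpha *: g) &
        supp (d - BR *m (y + alpha *: g)) \proper supp (d - BR *m y)].
Proof.
move=> vP Py nvert.
have [x [Ax x0 xS]] := nonvertex_direction Py nvert.
have [g0 g0c g0S] := circuit_of_support Ax x0 xS.
have slackE z i : (d - BR *m z) i 0 = slack z i by rewrite 2!mxE.
(* The sign of the circuit is chosen so that some constraint increases along it, which bounds the
   step. *)
have [g [j0 [gc gS gj0]]] : exists (g : 'cV[R]_n) (j0 : 'I_q), [/\ circuits A B g,
    forall i, slack y i = 0 -> (BR *m g) i 0 = 0 & 0 < (BR *m g) j0 0].
  have g0S' i : slack y i = 0 -> (BR *m g0) i 0 = 0.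
    move=> yi; apply/eqP; move/fintype.subsetP: g0S => /(_ i).
    by rewrite !inE slackE yi eqxx => /contraTT; apply.
  have /matrix0Pn [j [k]] : BR *m g0 != 0.
    case: g0c => Ag0 + _ _; apply: contraNN => /eqP Bg0.
    exact/eqP/(pointed vP).
  rewrite ord1 neq_lt => /orP[] gj; last by exists g0, j.
  exists (- g0), j; split; first exact: circuitN.
    by move=> i /g0S' yi; rewrite mulmxN mxE yi oppr0.
  by rewrite mulmxN mxE oppr_gt0.
have Ag : AR *m g = 0 by case: gc.
(* Ratio test: the minimal ratio is the maximal step length, and the minimizing constraint [j]
   becomes tight. *)
pose ratio i := slack y i / (BR *m g) i 0.
case: (@arg_minP _ _ _ j0 (fun i => 0 < (BR *m g) i 0) ratio gj0) => j gj jmin.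
(* A backward step of length [(1 + S)^-1] is feasible since each summand is at most [S]. Where the
   slack is 0, [g] leaves the constraint unchanged and the summand is 0. *)
pose S := \sum_i `|(BR *m g) i 0| / slack y i.
have S0 : 0 <= S by apply: sumr_ge0 => i _; rewrite divr_ge0 ?slack_ge0.
have yj : 0 < slack y j.
  by rewrite lt_neqAle slack_ge0 // andbT eq_sym; apply/eqP => /gS; move: gj; lra.
have alpha0 : 0 < ratio j by rewrite divr_gt0.
have Palpha : P (y + ratio j *: g).
  apply/polyhedron_addE => // i; have [gi|gi] := ltP 0 ((BR *m g) i 0).
    by rewrite -ler_pdivlMr // jmin.
  by apply: le_trans (slack_ge0 i Py); rewrite pmulr_rle0.
have slackD i : slack (y + ratio j *: g) i = slack y i - ratio j * (BR *m g) i 0.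
  by rewrite mulmx_addZE; lra.
exists g, (ratio j), (1 + S)^-1; split=> //.
- by rewrite alpha0 invr_gt0 ltr_wpDr.
- rewrite -scaleNr; apply/polyhedron_addE => // i.
  have [yi0|yi0] := eqVneq (slack y i) 0; first by rewrite gS // yi0 mulr0.
  have yi : 0 < slack y i by rewrite lt_neqAle eq_sym yi0 slack_ge0.
  rewrite mulNr -mulrN ler_pdivrMl ?ltr_wpDr // -ler_pdivrMr //.
  apply: (@le_trans _ _ (`|(BR *m g) i 0| / slack y i)).
    by rewrite ler_pM2r ?invr_gt0 // -normrN ler_norm.
  rewrite /S (bigD1 i) //= addrCA lerDl addr_ge0 //.
  by apply: sumr_ge0 => k _; rewrite divr_ge0 ?slack_ge0.
- exists g, (ratio j); split=> // a aj /(polyhedron_addE _ Py Ag) /(_ j).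
  by rewrite -ler_pdivlMr // leNgt aj.
apply/properP; split.
  apply/fintype.subsetP => i; rewrite !inE !slackE slackD; apply: contraNN => /eqP yi.
  by rewrite yi gS // mulr0 subr0.
exists j; first by rewrite inE slackE gt_eqF.
by rewrite inE slackE slackD /ratio divfK ?subrr ?eqxx // gt_eqF.
Qed.

(** * Paths of maximal circuit steps from arbitrary points *)

Definition circuit_path k (z : nat -> 'cV[R]_n) : Prop :=
  forall i, (i < k)%N -> P (z i) /\ maximal_circuit_step A B b d (z i) (z i.+1).

(** The number of inactive constraints drops with every step, so the process ends. *)
Lemma path_to_vertex v y : is_vertex P v -> P y ->
  exists k z, [/\ z 0%N = y, is_vertex P (z k) & circuit_path k z].
Proof.
move=> vP.
have [m] := ubnP #|supp (d - BR *m y)|; elim: m => // m IH in y * => ym Py.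
have [yP|nvert] := pselect (is_vertex P y).
  by exists 0%N, (fun=> y).
have [g [alpha [_ [_ _ Py' step lt_act]]]] := bidirectional_step vP Py nvert.
have [|k [z [z0 zk zstep]]] := IH (y + alpha *: g) _ Py'.
  by rewrite -ltnS (leq_trans _ ym) // ltnS proper_card.
exists k.+1, (fun i => if i is i'.+1 then z i' else y); split=> //.
by case=> [|i] ik; [rewrite z0 | exact: zstep].
Qed.

Lemma irreversible_path v y : is_vertex P v -> P y -> ~ is_vertex P y ->
  exists k z, [/\ z 0%N = y, is_vertex P (z k.+1), circuit_path k.+1 z &
    ~ maximal_circuit_step A B b d (z 1%N) (z 0%N)].
Proof.
move=> vP Py nvert.
have [g [alpha [eps [[alpha0 eps0] Peps Py' step _]]]] := bidirectional_step vP Py nvert.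
have [k [z [z0 zk zstep]]] := path_to_vertex vP Py'.
exists k, (fun i => if i is i'.+1 then z i' else y); split=> //.
  by case=> [|i] ik; [rewrite z0 | exact: zstep].
rewrite z0 => -[g' [beta [_ beta0 yE]]].
have betag : beta *: g' = - (alpha *: g).
  by apply: (addrI (y + alpha *: g)); rewrite -yE addrK.
have lt1 : 1 < (alpha + eps) / alpha by rewrite ltr_pdivlMr // mul1r ltrDl.
(* This multiple prolongs the reversed step beyond [y] to [y - eps *: g], which lies in [P]. *)
move=> /(_ (beta * ((alpha + eps) / alpha))) []; first by rewrite ltr_pMr.
rewrite mulrC -scalerA betag scalerN scalerA divfK ?gt_eqF // -addrA.
by rewrite -scalerBl opprD addrA subrr sub0r scaleNr.
Qed.

End Circuits.

Theorem theorem2 (R : realType) (n p q : nat)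
  (A : 'M[rat]_(p, n)) (B : 'M[rat]_(q, n)) (b : 'cV[R]_p) (d : 'cV[R]_q) :
  (forall (k : nat) (y : nat -> 'cV[R]_n),
     circuit_walk A B b d k y -> reversible A B b d k y)
  <->
  (forall (k : nat) (y : nat -> 'cV[R]_n),
     circuit_walk A B b d k y -> vertex_walk A B b d k y).
Proof.
split=> [rev|vert] k y walk; have [y0 yk ystep] := walk.
  split=> // i ik; apply: contrapT => nvert.
  have {}ik : (i < k)%N.
    by rewrite ltn_neqAle ik andbT; apply/eqP => ki; rewrite ki in nvert.
  have [Pyi _] := ystep i ik.
  have [m [z [z0 zm zstep]]] := irreversible_path y0 Pyi nvert; apply.
  (* The walk is rerouted at the non-vertex [y i]; both pieces agree at index [i] because
     [z 0 = y i]. *)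
  pose w j := if (j < i)%N then y j else z (j - i)%N.
  have wz j : w (i + j)%N = z j by rewrite /w ltnNge leq_addr addKn.
  have wy j : (j <= i)%N -> w j = y j.
    rewrite leq_eqVlt /w => /predU1P[->|->//].
    by rewrite ltnn subnn.
  have wwalk : circuit_walk A B b d (i + m.+1) w.
    split; [by rewrite wy | by rewrite wz|] => j jm.
    have [ji|ij] := ltnP j i.
      by rewrite !wy // 1?ltnW //; apply/ystep/(ltn_trans ji).
    by rewrite -(subnKC ij) -addnS !wz; apply: zstep; rewrite ltn_subLR.
  (* Step [m] of the reversed walk leads from [w (i + 1)] back to [w i], that is, from [z 1] to
     [z 0]. *)
  have [_ [_ _ /(_ m)]] := rev _ _ wwalk.
  have -> : (i + m.+1 - m = i + 1)%N by rewrite -addSnnS addnK addn1.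
  have -> : (i + m.+1 - m.+1 = i + 0)%N by rewrite addnK addn0.
  by rewrite !wz addnS ltnS leq_addl => /(_ isT) [].
have [_ yvert] := vert _ _ walk.
split=> //; split; rewrite ?subn0 ?subnn // => i ik.
have ki : (k - i.+1 < k)%N by rewrite ltn_subrL (leq_trans _ ik).
have yiP := yvert _ (ltnW ki).
have [_] := ystep _ ki.
rewrite subnSK // => -[g [alpha [gc alpha0 yE _]]].
have yk_i : is_vertex (polyhedron A B b d) (y (k - i)%N).
  by apply: yvert; rewrite leq_subr.
split; first exact: vertex_mem.
exists (- g), alpha; split=> //; first exact: circuitN.
  by rewrite yE scalerN addrK.
(* A longer reversed step would put the vertex [y (k - i.+1)] strictly between two points of [P] on
   a line in direction [g]. *)
move=> beta lt_beta Pbeta; case: (gc) => _ /eqP g0 _ _; apply: g0.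
apply: (vertex_extreme (s := alpha) (t := beta - alpha) yiP) => //.
- by rewrite subr_gt0.
- by rewrite -yE; apply: vertex_mem.
- by move: Pbeta; rewrite yE scalerN -addrA -scalerBl -opprB scaleNr.
Qed.
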